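(* The clone $\langle\mathsf{DMA},\Box,\Delta_{\langle\mathsf n,\mathsf b\rangle}\rangle$ is exactly the set of all partially harmonious De Morgan functions which preserve $\mathrm{B}_2$, $\mathrm{K}_3$ and $\mathrm{P}_3$.
   Context: Let $\mathrm{DM}_4=\{\mathsf t,\mathsf f,\mathsf n,\mathsf b\}$. The truth order $\le$ has $\mathsf f$ least, $\mathsf t$ greatest, $\mathsf n,\mathsf b$ incomparable; $\wedge,\vee$ are its meet and join. De Morgan negation: $-\mathsf t=\mathsf f$, $-\mathsf f=\mathsf t$, $-\mathsf n=\mathsf n$, $-\mathsf b=\mathsf b$. Conflation: $\partial\mathsf t=\mathsf t$, $\partial\mathsf f=\mathsf f$, $\partial\mathsf n=\mathsf b$, $\partial\mathsf b=\mathsf n$. $\Box a=\mathsf t$ if $a=\mathsf t$ and $\mathsf f$ otherwise. $\Delta_{\langle\mathsf n,\mathsf b\rangle}(a,b)=\mathsf t$ if $a=\mathsf n$ and $b=\mathsf b$, and $\mathsf f$ otherwise. A De Morgan function is a map $\mathrm{DM}_4^n\to\mathrm{DM}_4$, $n\ge1$; a clone is a set of such functions closed under composition and containing all projections; constants are unary constant functions. $\mathsf{DMA}$ is the clone generated by $\wedge,\vee,\mathsf t,\mathsf f,-$; $\langle\mathsf{DMA},g_1,g_2\rangle$ is the clone generated by $\mathsf{DMA}\cup\{g_1,g_2\}$. $\mathrm{B}_2=\{\mathsf t,\mathsf f\}$, $\mathrm{K}_3=\{\mathsf t,\mathsf n,\mathsf f\}$, $\mathrm{P}_3=\{\mathsf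 t,\mathsf b,\mathsf f\}$; $f$ preserves $X$ if arguments in $X$ give values in $X$. A De Morgan function $f$ is partially harmonious if $f(\partial\overline a)=\partial f(\overline a)$ whenever all entries of $\overline a$ lie in $\mathrm{K}_3$ or all entries of $\overline a$ lie in $\mathrm{P}_3$ ($\partial$ applied componentwise). *)

(* Defs.v *)
From HB Require Import structures.
From mathcomp Require Import all_boot all_order.

Set Implicit Arguments.
Unset Strict Implicit.
Unset Printing Implicit Defensive.

Inductive DM4 : Type := DMt | DMf | DMn | DMb.

Definition DM4_code (a : DM4) : bool * bool :=
  match a with
  | DMt => (true, true) | DMf => (false, false)
  | DMn => (true, false) | DMb => (false, true)
  end.

Definition DM4_decode (c : bool * bool) : DM4 :=
  match c with
  | (true, true) => DMt | (false, false) => DMf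
  | (true, false) => DMn | (false, true) => DMb
  end.

Lemma DM4_codeK : cancel DM4_code DM4_decode. Proof. by case. Qed.

HB.instance Definition _ := Finite.copy DM4 (can_type DM4_codeK).

Definition DM4_le (a b : DM4) : bool :=
  match a, b with
  | DMf, _ | _, DMt | DMn, DMn | DMb, DMb => true
  | _, _ => false
  end.

Definition DM4_lt (a b : DM4) : bool := (b != a) && DM4_le a b.

Definition DM4_meet (a b : DM4) : DM4 :=
  if DM4_le a b then a else if DM4_le b a then b else DMf.

Definition DM4_join (a b : DM4) : DM4 :=
  if DM4_le a b then b else if DM4_le b a then a else DMt.

Lemma DM4_lt_def a b : DM4_lt a b = (b != a) && DM4_le a b. Proof. by []. Qed.
Lemma DM4_le_def a b : DM4_le a b = (DM4_meet a b == a).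
Proof. by case: a b => -[]. Qed.
Lemma DM4_meetC : commutative DM4_meet. Proof. by do 2!case. Qed.
Lemma DM4_joinC : commutative DM4_join. Proof. by do 2!case. Qed.
Lemma DM4_meetA : associative DM4_meet. Proof. by do 3!case. Qed.
Lemma DM4_joinA : associative DM4_join. Proof. by do 3!case. Qed.
Lemma DM4_joinKI b a : DM4_meet a (DM4_join a b) = a.
Proof. by case: a b => -[]. Qed.
Lemma DM4_meetKU b a : DM4_join a (DM4_meet a b) = a.
Proof. by case: a b => -[]. Qed.
Lemma DM4_meetUl : left_distributive DM4_meet DM4_join. Proof. by do 3!case. Qed.
Lemma DM4_meetxx : idempotent_op DM4_meet. Proof. by case. Qed.

Fact DM4_display : Order.disp_t. Proof. exact: Order.Disp tt tt. Qed.

HB.instance Definition _ :=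
  Order.isMeetJoinDistrLattice.Build DM4_display DM4
    DM4_le_def DM4_lt_def DM4_meetC DM4_joinC DM4_meetA DM4_joinA
    DM4_joinKI DM4_meetKU DM4_meetUl DM4_meetxx.

Lemma DM4_le0x a : DM4_le DMf a. Proof. by []. Qed.
Lemma DM4_lex1 a : DM4_le a DMt. Proof. by case: a. Qed.

HB.instance Definition _ := Order.hasBottom.Build DM4_display DM4 DM4_le0x.
HB.instance Definition _ := Order.hasTop.Build DM4_display DM4 DM4_lex1.

Definition DM4_neg (a : DM4) : DM4 :=
  match a with DMt => DMf | DMf => DMt | DMn => DMn | DMb => DMb end.

Definition conflation (a : DM4) : DM4 :=
  match a with DMt => DMt | DMf => DMf | DMn => DMb | DMb => DMn end.

Definition box (a : DM4) : DM4 := if a == DMt then DMt else DMf.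

Definition Delta_nb (a b : DM4) : DM4 :=
  if (a == DMn) && (b == DMb) then DMt else DMf.

Definition B2 : {set DM4} := [set DMt; DMf].
Definition K3 : {set DM4} := [set DMt; DMn; DMf].
Definition P3 : {set DM4} := [set DMt; DMb; DMf].

(* As a finite function, so that extensionally equal operations are equal. *)
Definition dmfun (n : nat) : Type := {ffun n.-tuple DM4 -> DM4}.

Definition proj_op n (i : 'I_n) : dmfun n := [ffun a => tnth a i].

Definition comp_op m n (f : dmfun m) (g : 'I_m -> dmfun n) : dmfun n :=
  [ffun a => f [tuple g i a | i < m]].

Definition op1 (g : DM4 -> DM4) : dmfun 1 := [ffun a => g (tnth a ord0)].

Definition op2 (g : DM4 -> DM4 -> DM4) : dmfun 2 :=
  [ffun a => g (tnth a ord0) (tnth a ord_max)].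

(* The index n stands for arity n.+1: nullary operations are excluded. *)
Definition dmset : Type := forall n : nat, dmfun n.+1 -> Prop.

Definition is_clone (C : dmset) : Prop :=
  (forall n (i : 'I_n.+1), C n (proj_op i)) /\
  (forall m n (f : dmfun m.+1) (g : 'I_m.+1 -> dmfun n.+1),
     C m f -> (forall i, C n (g i)) -> C n (comp_op f g)).

Definition clone_gen (G : dmset) : dmset := fun n f =>
  forall C : dmset,
    is_clone C -> (forall k (g : dmfun k.+1), G k g -> C k g) -> C n f.

Inductive DMA_generator : dmset :=
  | DMA_meet : DMA_generator (op2 (fun a b : DM4 => Order.meet a b))
  | DMA_join : DMA_generator (op2 (fun a b : DM4 => Order.join a b))
  | DMA_true : DMA_generator (op1 (fun=> DMt))
  | DMA_false : DMA_generator (op1 (fun=> DMf))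
  | DMA_neg : DMA_generator (op1 DM4_neg).

Definition DMA : dmset := clone_gen DMA_generator.

Inductive adjoin2 (S : dmset) k1 (g1 : dmfun k1.+1) k2 (g2 : dmfun k2.+1) :
    dmset :=
  | adjoin2_base n (f : dmfun n.+1) : S n f -> adjoin2 S g1 g2 f
  | adjoin2_fst : adjoin2 S g1 g2 g1
  | adjoin2_snd : adjoin2 S g1 g2 g2.

Definition DMA_with k1 (g1 : dmfun k1.+1) k2 (g2 : dmfun k2.+1) : dmset :=
  clone_gen (adjoin2 DMA g1 g2).

Definition preserves n (X : {set DM4}) (f : dmfun n) : Prop :=
  forall a : n.-tuple DM4, {subset a <= X} -> f a \in X.

Definition partially_harmonious n (f : dmfun n) : Prop :=
  forall a : n.-tuple DM4, {subset a <= K3} \/ {subset a <= P3} ->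
    f (map_tuple conflation a) = conflation (f a).

(* Main.v *)
Require Import Defs.
From mathcomp Require Import all_boot all_order.

(** For soundness, the functions in question form a clone containing the
    generators.  For completeness, it suffices to find, for each tuple [a], a
    function [g] of the clone that lies below [f] and agrees with [f] at [a]:
    then [f] is the join of these functions.  Take [g x = h x /\ v x], where [h]
    is the indicator of [a] if [a] contains both [n] and [b], and the indicator
    of [{a, conflation a}] otherwise, and where [v] is a constant or a
    projection with [v a = f a]; such a [v] exists because [f] preserves [K3]
    and [P3].  The indicator [h] is a conjunction of conditions on pairs of
    coordinates, each of which is expressible by [box] and [Delta_nb]. *)

Set Implicit Arguments.
Unset Strict Implicit.
Unset Printing Implicit Defensive.

Import Order.TTheory.

(** * Functions and predicates expressible by a set of operations *)

Definition represents (C : dmset) n (g : n.+1.-tuple DM4 -> DM4) : Prop :=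
  C n (finfun g).

Definition DM4_of_bool (c : bool) : DM4 := if c then DMt else DMf.

Definition decides (C : dmset) n (P : n.+1.-tuple DM4 -> bool) : Prop :=
  represents C (fun x => DM4_of_bool (P x)).

Lemma eq_represents (C : dmset) n (g h : n.+1.-tuple DM4 -> DM4) :
  g =1 h -> represents C g -> represents C h.
Proof.
move=> eq_gh; rewrite /represents; suff -> : finfun g = finfun h by [].
by apply/ffunP=> x; rewrite !ffunE.
Qed.

Lemma eq_decides (C : dmset) n (P Q : n.+1.-tuple DM4 -> bool) :
  P =1 Q -> decides C P -> decides C Q.
Proof. by move=> eqPQ; apply: eq_represents => x; rewrite eqPQ. Qed.

Lemma subset_tuple n (X : {set DM4}) (a : n.-tuple DM4) :
  {subset a <= X} <-> forall i, tnth a i \in X.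
Proof.
split=> [aX i | aX _ /tnthP[i ->]]; last exact: aX.
by apply: aX; apply: mem_tnth.
Qed.

(** * Indicators of pairs and what they determine about tuples *)

Definition mixed_pair (p q : DM4) : bool :=
  (p == DMn) && (q == DMb) || (p == DMb) && (q == DMn).

(** A partially harmonious function with values in [B2] cannot separate a non-mixed pair from its
    conflation, so both are accepted; a mixed pair can be isolated. *)
Definition pair_indicator (p q u v : DM4) : bool :=
  (u == p) && (v == q) ||
  [&& ~~ mixed_pair p q, u == conflation p & v == conflation q].

Definition coord_indicator (p u : DM4) : bool :=
  (u == p) || (u == conflation p).

Lemma coord_indicatorE p u :
  coord_indicator p u =
    if p == DMt then u == DMt else if p == DMf then u == DMf
    else ~~ (u == DMt) && ~~ (u == DMf).
Proof. by case: p u => -[]. Qed.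

(** The right side uses only tests that [box], negation and [Delta_nb] can express. When [p] and [q]
    are both nonclassical, the coordinate tests leave four pairs, and [Delta_nb] picks one mixed
    pair or excludes both. *)
Lemma pair_indicatorE p q u v :
  pair_indicator p q u v =
    [&& coord_indicator p u, coord_indicator q v,
        mixed_pair p q ==>
          (if p == DMn then (u == DMn) && (v == DMb)
           else (v == DMn) && (u == DMb)) &
        ((p == q) && (p \notin B2)) ==>
          ~~ ((u == DMn) && (v == DMb)) && ~~ ((v == DMn) && (u == DMb))].
Proof. by rewrite !inE; case: p q u v => -[] [] []. Qed.

Lemma pair_indicator_refl p q : pair_indicator p q p q.
Proof. by rewrite /pair_indicator !eqxx. Qed.

Lemma pair_indicators_eq n (a x : n.-tuple DM4) :
    (forall i j, pair_indicator (tnth a i) (tnth a j) (tnth x i) (tnth x j)) ->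
  x = a \/ ({subset a <= K3} \/ {subset a <= P3}) /\ x = map_tuple conflation a.
Proof.
move=> xa; have [/forallP eq_xa | ] := boolP [forall i, tnth x i == tnth a i].
  by left; apply: eq_from_tnth => i; apply/eqP.
rewrite negb_forall => /existsP[i ne_i]; right.
(* Since [x] and [a] differ at [i], every pair [(i, j)] must take the conflation alternative. *)
have xa_i j : ~~ mixed_pair (tnth a i) (tnth a j) /\
    tnth x j = conflation (tnth a j).
  have := xa i j; rewrite /pair_indicator (negPf ne_i) /=.
  by case/and3P=> ? _ /eqP.
split; last by apply: eq_from_tnth => j; rewrite tnth_map (xa_i j).2.
(* Conflation fixes [B2] but moves this entry, so it is [n] or [b]; having no mixed pair with it
   keeps all entries in [K3] or [P3] respectively. *)
have: tnth a i \notin B2.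
  by move: ne_i; rewrite (xa_i i).2 !inE; case: (tnth a i).
case Da: (tnth a i); rewrite ?inE // => _.
- left; apply/subset_tuple=> j.
  by have := (xa_i j).1; rewrite Da !inE; case: (tnth a j).
- right; apply/subset_tuple=> j.
  by have := (xa_i j).1; rewrite Da !inE; case: (tnth a j).
Qed.

(** * Pointwise application of operations inside a clone *)

Section Clone.

Variable C : dmset.
Arguments C : clear implicits.
Hypothesis cloneC : is_clone C.

Lemma represents_proj n (i : 'I_n.+1) : represents C (fun x => tnth x i).
Proof. exact: cloneC.1. Qed.

Lemma represents_op1 n g (u : n.+1.-tuple DM4 -> DM4) :
  C 0 (op1 g) -> represents C u -> represents C (fun x => g (u x)).
Proof.
move=> Cg Cu; have Cgu := cloneC.2 _ _ _ (fun=> finfun u) Cg (fun=> Cu).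
rewrite /represents; congr (C n _): Cgu.
by apply/ffunP=> x; rewrite !ffunE tnth_mktuple.
Qed.

Lemma represents_op2 n g (u v : n.+1.-tuple DM4 -> DM4) :
    C 1 (op2 g) -> represents C u -> represents C v ->
  represents C (fun x => g (u x) (v x)).
Proof.
move=> Cg Cu Cv.
have Cuv (i : 'I_2) : C n (if i == ord0 then finfun u else finfun v).
  by case: ifP.
have Cguv := cloneC.2 _ _ _ _ Cg Cuv.
rewrite /represents; congr (C n _): Cguv.
by apply/ffunP=> x; rewrite !ffunE !tnth_mktuple /= !ffunE.
Qed.

End Clone.

(** * Completeness, inside an arbitrary clone containing the generators *)

Section Completeness.

Variable C : dmset.
Arguments C : clear implicits.
Hypothesis cloneC : is_clone C.
Hypothesis DMA_C : forall k (g : dmfun k.+1), DMA_generator g -> C k g.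
Hypothesis box_C : C 0 (op1 box).
Hypothesis Delta_C : C 1 (op2 Delta_nb).

Lemma represents_meet n (u v : n.+1.-tuple DM4 -> DM4) :
    represents C u -> represents C v ->
  represents C (fun x => Order.meet (u x) (v x)).
Proof. exact: represents_op2 (DMA_C DMA_meet). Qed.

Lemma represents_join n (u v : n.+1.-tuple DM4 -> DM4) :
    represents C u -> represents C v ->
  represents C (fun x => Order.join (u x) (v x)).
Proof. exact: represents_op2 (DMA_C DMA_join). Qed.

Lemma represents_neg n (u : n.+1.-tuple DM4 -> DM4) :
  represents C u -> represents C (fun x => DM4_neg (u x)).
Proof. exact: represents_op1 (DMA_C DMA_neg). Qed.

Lemma decides_const n c : decides C (fun _ : n.+1.-tuple DM4 => c).
Proof.
(* Constants are unary, so they reach arity [n.+1] by composition with a projection. *)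
have Cp := represents_proj cloneC (@ord0 n).
case: c; first exact: (represents_op1 cloneC (DMA_C DMA_true) Cp).
exact: (represents_op1 cloneC (DMA_C DMA_false) Cp).
Qed.

Lemma decides_and n (P Q : n.+1.-tuple DM4 -> bool) :
  decides C P -> decides C Q -> decides C (fun x => P x && Q x).
Proof.
move=> CP CQ; apply: eq_represents (represents_meet CP CQ) => x.
by case: (P x) (Q x) => -[].
Qed.

Lemma decides_neg n (P : n.+1.-tuple DM4 -> bool) :
  decides C P -> decides C (fun x => ~~ P x).
Proof. by move/represents_neg; apply: eq_represents => x; case: (P x). Qed.

Lemma decides_all n (I : Type) (s : seq I) (P : n.+1.-tuple DM4 -> pred I) :
    (forall i, decides C (fun x => P x i)) -> decides C (fun x => all (P x) s).
Proof.
move=> CP; elim: s => [|i s IHs]; first exact: (decides_const n true).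
exact: decides_and.
Qed.

Lemma decides_eq_true n (i : 'I_n.+1) : decides C (fun x => tnth x i == DMt).
Proof. exact: represents_op1 box_C (represents_proj cloneC i). Qed.

Lemma decides_eq_false n (i : 'I_n.+1) : decides C (fun x => tnth x i == DMf).
Proof.
have Ci := represents_neg (represents_proj cloneC i).
apply: eq_represents (represents_op1 cloneC box_C Ci) => x.
by case: (tnth x i).
Qed.

Lemma decides_nb n (i j : 'I_n.+1) :
  decides C (fun x => (tnth x i == DMn) && (tnth x j == DMb)).
Proof.
have Cp := represents_proj cloneC.
exact: (represents_op2 cloneC Delta_C (Cp n i) (Cp n j)).
Qed.

Lemma decides_pair_indicator n p q (i j : 'I_n.+1) :
  decides C (fun x => pair_indicator p q (tnth x i) (tnth x j)).
Proof.
have Ccoord r k : decides C (fun x : n.+1.-tuple DM4 =>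
    coord_indicator r (tnth x k)).
  apply: eq_decides => [x|]; first by rewrite coord_indicatorE.
  have [_|_] := eqVneq r DMt; first exact: decides_eq_true.
  have [_|_] := eqVneq r DMf; first exact: decides_eq_false.
  apply: decides_and; apply: decides_neg.
    exact: decides_eq_true.
  exact: decides_eq_false.
apply: eq_decides => [x|]; first by rewrite pair_indicatorE.
apply: (decides_and (Ccoord p i)); apply: (decides_and (Ccoord q j)).
apply: decides_and.
  case: mixed_pair; last exact: (decides_const _ true).
  by case: (p == DMn); apply: decides_nb.
case: (_ && _); last exact: (decides_const _ true).
by apply: decides_and; apply: decides_neg; apply: decides_nb.
Qed.

Lemma decides_tuple_indicator n (a : n.+1.-tuple DM4) :
  decides C (fun x => all (fun ij =>
    pair_indicator (tnth a ij.1) (tnth a ij.2) (tnth x ij.1) (tnth x ij.2))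
    (enum {: 'I_n.+1 * 'I_n.+1})).
Proof. by apply: decides_all => ij; apply: decides_pair_indicator. Qed.


Lemma represents_lower_approx n (f : dmfun n.+1) (a : n.+1.-tuple DM4) :
    partially_harmonious f -> preserves K3 f -> preserves P3 f ->
  exists g, [/\ represents C g, forall x, Order.le (g x) (f x) & g a = f a].
Proof.
move=> hf fK fP.
have [v [Cv va v_conf]] : exists v, [/\ represents C v, v a = f a &
    forall x, v (map_tuple conflation x) = conflation (v x)].
  have Cproj i: f a = tnth a i -> exists v, [/\ represents C v, v a = f a &
      forall x, v (map_tuple conflation x) = conflation (v x)].
    move=> fai; exists (fun x => tnth x i).
    by split=> [||x]; [exact: represents_proj | | rewrite tnth_map].
  case Dfa: (f a).
  - by exists (fun=> DMt); split=> //; apply: (decides_const _ true).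
  - by exists (fun=> DMf); split=> //; apply: (decides_const _ false).
  (* If all entries were in [P3], so would be [f a], which is [n]. Hence some entry is outside [P3],
     that is, equal to [n], and its projection serves as [v]. The next case is dual. *)
  - have [/forallP aP | ] := boolP [forall i, tnth a i \in P3].
      by have := fP a (proj2 (subset_tuple P3 a) aP); rewrite Dfa !inE.
    rewrite negb_forall => /existsP[i ai]; rewrite -Dfa; apply: (Cproj i).
    by rewrite Dfa; move: ai; rewrite !inE; case: (tnth a i).
  - have [/forallP aK | ] := boolP [forall i, tnth a i \in K3].
      by have := fK a (proj2 (subset_tuple K3 a) aK); rewrite Dfa !inE.
    rewrite negb_forall => /existsP[i ai]; rewrite -Dfa; apply: (Cproj i).
    by rewrite Dfa; move: ai; rewrite !inE; case: (tnth a i).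
have Ch := decides_tuple_indicator a.
exists (fun x => Order.meet (v x) (DM4_of_bool (all (fun ij =>
  pair_indicator (tnth a ij.1) (tnth a ij.2) (tnth x ij.1) (tnth x ij.2))
  (enum {: 'I_n.+1 * 'I_n.+1})))).
split; first exact: represents_meet.
- move=> x; case: allP => [xa | _]; last by rewrite meetx0 le0x.
  rewrite meetx1; have xa_ij i j := xa (i, j) (mem_enum _ _).
  have [->|[pure_a ->]] := pair_indicators_eq xa_ij; first by rewrite va.
  (* At [conflation a], both [v] and [f] take the value [conflation (f a)]; for [f] this is partial
     harmony. *)
  by rewrite v_conf va hf.
- suff -> : all (fun ij => pair_indicator (tnth a ij.1) (tnth a ij.2)
      (tnth a ij.1) (tnth a ij.2)) (enum {: 'I_n.+1 * 'I_n.+1}).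
    by rewrite meetx1.
  by apply/allP=> ij _; apply: pair_indicator_refl.
Qed.

Lemma clone_contains n (f : dmfun n.+1) :
    partially_harmonious f -> preserves K3 f -> preserves P3 f ->
  C n f.
Proof.
move=> hf fK fP.
suff [g [Cg _ gE]] : exists g, [/\ represents C g,
    forall x, Order.le (g x) (f x) &
    {in enum {: n.+1.-tuple DM4}, forall a, g a = f a}].
  suff <- : finfun g = f by [].
  by apply/ffunP=> x; rewrite ffunE gE ?mem_enum.
(* The induction is on the list of tuples where [g] agrees with [f]; the bound [g <= f] holds
   everywhere, so joining a new approximation keeps earlier agreements. *)
elim: (enum _) => [|a s [g [Cg le_gf gE]]].
  exists (fun=> DMf); split=> [|x|//]; last exact: le0x.
  exact: (decides_const _ false).
have [h [Ch le_hf ha]] := represents_lower_approx a hf fK fP.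
exists (fun x => Order.join (h x) (g x)); split=> [|x|x].
- exact: represents_join.
- by rewrite leUx le_hf le_gf.
rewrite inE => /predU1P[->|xs]; first by rewrite ha; apply/join_l/le_gf.
by rewrite gE //; apply/join_r/le_hf.
Qed.

End Completeness.

(** * Soundness *)

Definition pres_harmonious : dmset := fun n f =>
  [/\ partially_harmonious f, preserves B2 f, preserves K3 f & preserves P3 f].

Lemma preserves_comp m n (X : {set DM4}) (f : dmfun m) (g : 'I_m -> dmfun n) :
  preserves X f -> (forall i, preserves X (g i)) -> preserves X (comp_op f g).
Proof.
move=> fX gX a aX; rewrite ffunE; apply/fX/subset_tuple=> i.
by rewrite tnth_mktuple; apply: gX.
Qed.

Lemma preserves_proj n (X : {set DM4}) (i : 'I_n) : preserves X (proj_op i).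
Proof. by move=> a /subset_tuple aX; rewrite ffunE. Qed.

Lemma pres_harmonious_clone : is_clone pres_harmonious.
Proof.
split=> [n i | m n f g [hf fB fK fP] g_ok].
  split; try exact: preserves_proj.
  by move=> a _; rewrite !ffunE tnth_map.
split; try by apply: preserves_comp => // i; case: (g_ok i).
(* Harmony of [f] applies to the tuple of inner values because each [g i] preserves [K3] and
   [P3]. *)
move=> a pure_a; rewrite !ffunE -hf.
  congr (f _); apply: eq_from_tnth => i.
  by rewrite [RHS]tnth_map !tnth_mktuple; case: (g_ok i) => ->.
case: pure_a => [aK | aP]; [left | right]; apply/subset_tuple=> i;
  by rewrite tnth_mktuple; case: (g_ok i) => _ _ gK gP; auto.
Qed.

Lemma pres_harmonious_op1 (g : DM4 -> DM4) :
    (forall u, g (conflation u) = conflation (g u)) ->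
    {in B2, forall u, g u \in B2} -> {in K3, forall u, g u \in K3} ->
    {in P3, forall u, g u \in P3} ->
  pres_harmonious (op1 g).
Proof.
move=> hg gB gK gP.
split; try by move=> a /subset_tuple aX; rewrite ffunE; auto.
by move=> a _; rewrite !ffunE tnth_map.
Qed.

(** Harmony is asked only within [K3] or [P3]: [Delta_nb] violates it at [(n, b)]. *)
Lemma pres_harmonious_op2 (g : DM4 -> DM4 -> DM4) :
    (forall X, X = K3 \/ X = P3 -> {in X &, forall u v,
       g (conflation u) (conflation v) = conflation (g u v)}) ->
    {in B2 &, forall u v, g u v \in B2} ->
    {in K3 &, forall u v, g u v \in K3} ->
    {in P3 &, forall u v, g u v \in P3} ->
  pres_harmonious (op2 g).
Proof.
move=> hg gB gK gP.
split; try by move=> a /subset_tuple aX; rewrite ffunE; auto.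
move=> a pure_a; rewrite !ffunE !tnth_map.
by case: pure_a => /subset_tuple aX; [apply: (hg K3) | apply: (hg P3)]; auto.
Qed.

Lemma DMA_with_box_Delta_sub n (f : dmfun n.+1) :
  DMA_with (op1 box) (op2 Delta_nb) f -> pres_harmonious f.
Proof.
apply=> [|k _ [||]]; first exact: pres_harmonious_clone.
(* [DMA] is itself a generated clone, so its minimality reduces this case to the five basic
   operations. *)
- move=> m g; apply=> [|j _ []]; first exact: pres_harmonious_clone.
  + by apply: pres_harmonious_op2 => [_ [] -> u v|u v|u v|u v];
      rewrite !inE; case: u v => -[].
  + by apply: pres_harmonious_op2 => [_ [] -> u v|u v|u v|u v];
      rewrite !inE; case: u v => -[].
  + by apply: pres_harmonious_op1 => [u|u|u|u]; rewrite ?inE.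
  + by apply: pres_harmonious_op1 => [u|u|u|u]; rewrite ?inE.
  + by apply: pres_harmonious_op1 => [u|u|u|u]; rewrite ?inE; case: u.
- by apply: pres_harmonious_op1 => [u|u|u|u]; rewrite ?inE; case: u.
- by apply: pres_harmonious_op2 => [_ [] -> u v|u v|u v|u v];
    rewrite !inE; case: u v => -[].
Qed.

Theorem mainTheorem10 (n : nat) (f : dmfun n.+1) :
  DMA_with (op1 box) (op2 Delta_nb) f <->
  [/\ partially_harmonious f, preserves B2 f, preserves K3 f & preserves P3 f].
Proof.
split=> [|[hf _ fK fP] C cloneC genC]; first exact: DMA_with_box_Delta_sub.
apply: clone_contains => // [k g gen_g||].
- by apply/genC/adjoin2_base => D _; apply.
- exact/genC/adjoin2_fst.
- exact/genC/adjoin2_snd.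
Qed.
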